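(* Let $X$ be a complete CAT(0)-space with base point $x_0$, and let $g$ be an isometry of $X$ with $d_g:=\inf_{x\in X}d(x,gx)>0$. Then $g$ fixes a point $\gamma$ of the visual boundary of $X$. The metric functional corresponding to this point is fixed by $g$ and is the Busemann function $h=b_\gamma$ of the geodesic ray $\gamma$ from $x_0$ representing this boundary point. Moreover $h$ is the unique horofunction such that \[ h(gx)=h(x)-d_{g}\quad\text{for all }x\in X, \] and \[ \frac{1}{n}d(g^{n}x_{0},\gamma(d_{g}n))\rightarrow0\quad(n\to\infty). \]
   Context: The visual bordification of $X$ is $X$ together with the set of equivalence classes of geodesic rays (two rays equivalent if at bounded distance); isometries act on it naturally. For a geodesic ray $\gamma$ with $\gamma(0)=x_0$, its Busemann function is $b_\gamma(y)=\lim_{t\to\infty}(d(y,\gamma(t))-t)$. Metric functionals: with $\mathrm{Hom}(X,\mathbb{R})$ the $1$-Lipschitz functions with pointwise convergence topology and $h_y(\cdot)=d(\cdot,y)-d(x_0,y)$, they are the elements of the closure of $\{h_y\}$; an isometry $g$ acts on them by $(gh)(x)=h(g^{-1}x)-h(g^{-1}x_0)$. A horofunction is a limit of functions $h_{y_n}$ with respect to uniform convergence on bounded sets. *)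

(* Defs.v *)
From mathcomp Require Import all_boot all_order all_algebra.
From mathcomp Require Import all_classical all_reals all_analysis.
Set Implicit Arguments. Unset Strict Implicit. Unset Printing Implicit Defensive.
Import Order.TTheory GRing.Theory Num.Theory.
Local Open Scope ring_scope.
Local Open Scope classical_set_scope.

Section MetricDefs.
Context {R : realType} {T : Type}.
Variable d : T -> T -> R.

Definition is_metric : Prop :=
  (forall x y, 0 <= d x y) /\ (forall x y, d x y = 0 <-> x = y) /\
  (forall x y, d x y = d y x) /\ (forall x y z, d x z <= d x y + d y z).

Definition is_complete : Prop :=
  forall u : nat -> T,
    (forall e : R, 0 < e -> exists N, forall m n, (N <= m)%N -> (N <= n)%N -> d (u m) (u n) < e) ->
    exists l, forall e : R, 0 < e -> exists N, forall n, (N <= n)%N -> d (u n) l < e.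

Definition geodesic_segment (c : R -> T) (x y : T) : Prop :=
  c 0 = x /\ c (d x y) = y /\
  forall s t, 0 <= s <= d x y -> 0 <= t <= d x y -> d (c s) (c t) = `|s - t|.

Definition is_geodesic_space : Prop :=
  forall x y, exists c, geodesic_segment c x y.

Definition edist (P Q : R * R) : R :=
  Num.sqrt ((P.1 - Q.1) ^+ 2 + (P.2 - Q.2) ^+ 2).
Definition econv (P Q : R * R) (l : R) : R * R :=
  (P.1 + l * (Q.1 - P.1), P.2 + l * (Q.2 - P.2)).

(* CAT(0): geodesic metric space in which every geodesic triangle is at most
   as thin as its Euclidean comparison triangle.  Any two points on two
   different sides of a triangle lie on two sides issuing from a common vertex
   p; the third side [q,r] exists since X is geodesic. *)
Definition is_CAT0 : Prop :=
  is_metric /\ is_geodesic_space /\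
  forall (p q r : T) (c1 c2 : R -> T) (P Q Rr : R * R),
    geodesic_segment c1 p q -> geodesic_segment c2 p r ->
    edist P Q = d p q -> edist P Rr = d p r -> edist Q Rr = d q r ->
    forall s t, 0 <= s <= d p q -> 0 <= t <= d p r ->
      d (c1 s) (c2 t) <= edist (econv P Q (s / d p q)) (econv P Rr (t / d p r)).

Definition is_isometry (g ginv : T -> T) : Prop :=
  (forall x y, d (g x) (g y) = d x y) /\ cancel g ginv /\ cancel ginv g.

Definition transl_length (g : T -> T) : R := inf [set d x (g x) | x in setT].

Definition geodesic_ray (c : R -> T) : Prop :=
  forall s t, 0 <= s -> 0 <= t -> d (c s) (c t) = `|s - t|.

(* two rays are equivalent (same point of the visual boundary) *)
Definition rays_equiv (c c' : R -> T) : Prop :=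
  exists C : R, forall t, 0 <= t -> d (c t) (c' t) <= C.

Definition busemann (c : R -> T) (y : T) : R :=
  lim ((d y (c t) - t) @[t --> +oo]).

Definition hfun (x0 y : T) (x : T) : R := d x y - d x0 y.

(* metric functionals: closure of {h_y} for pointwise convergence *)
Definition metric_functional (x0 : T) (h : T -> R) : Prop :=
  forall F : set T, finite_set F -> forall e : R, 0 < e ->
    exists y, forall x, F x -> `|h x - hfun x0 y x| < e.

Definition act (x0 : T) (ginv : T -> T) (h : T -> R) : T -> R :=
  fun x => h (ginv x) - h (ginv x0).

Definition horofunction (x0 : T) (h : T -> R) : Prop :=
  exists y : nat -> T, forall r : R, forall e : R, 0 < e ->
    exists N, forall n, (N <= n)%N -> forall z, d x0 z <= r ->
      `|h z - hfun x0 (y n) z| < e.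

End MetricDefs.

(* Main.v *)
(** Every geometric step is an instance of Stewart's inequality
      d(z, c(lL))^2 <= (1-l) d(z, c(0))^2 + l d(z, c(L))^2 - l(1-l) L^2.
    Put A = d_g and x_k = g^k x_0.  Midpoints show d(x, g^n x) >= n A for n a
    power of two, so b(n) = d(x_0, x_n) - n A is infinitely often nonnegative
    and hence has, up to an additive constant, arbitrarily late running maxima
    n.  For these n, d(x_k, x_n) <= d(x_0, x_n) - A k + B for all k <= n, with
    B fixed.  If a point y satisfies d(x_k, y) <= d(x_0, y) - A k + B, Stewart
    puts x_k at distance o(k) from the point at time A k - B on the geodesic
    [x_0, y], whatever y is.  So any two such geodesics are close at each fixed
    time once k is large: they converge to a ray gam (completeness), gam
    tracks the orbit sublinearly, and any two metric functionals with
    h(x_k) <= B - A k for all k coincide.  The function b_gam(g x) -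
    b_gam(g x_0) is such a functional, whence b_gam(g x) = b_gam(x) +
    b_gam(g x_0); iterating along the orbit, the constant is -A. *)

Require Import Defs.
From mathcomp Require Import all_boot all_order all_algebra ring lra.
From mathcomp Require Import all_classical all_reals all_analysis.
Import Order.TTheory GRing.Theory Num.Theory.
Local Open Scope ring_scope.
Local Open Scope classical_set_scope.

Lemma ratio_itv {R : realFieldType} {t L : R} :
  0 < L -> 0 <= t <= L -> 0 <= t / L <= 1.
Proof.
move=> L0 /andP[t0 tL]; apply/andP; split; first by rewrite divr_ge0 // ltW.
by rewrite ler_pdivrMr // mul1r.
Qed.

Lemma natr_unbounded {R : realType} (M : R) :
  exists K, forall k, (K <= k)%N -> M <= k%:R.
Proof.
exists (Num.truncn M).+1 => k Kk.
by apply: le_trans (ltW (truncnS_gt M)) _; rewrite ler_nat.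
Qed.

(** * Comparison geometry: Stewart's inequality and its consequences *)

Section Geometry.
Set Implicit Arguments.
Unset Strict Implicit.
Context {R : realType} {T : Type} (d : T -> T -> R).
Hypothesis dCAT0 : is_CAT0 d.

(** The endpoints are left out so that restrictions, reversals and isometric images of a geodesic
    need no bookkeeping. *)
Definition isometric_on (c : R -> T) (L : R) : Prop :=
  forall s t, 0 <= s <= L -> 0 <= t <= L -> d (c s) (c t) = `|s - t|.

Lemma dist_ge0 x y : 0 <= d x y.
Proof. by case: dCAT0 => -[+ _] _; exact. Qed.

Lemma dist0P x y : d x y = 0 <-> x = y.
Proof. by case: dCAT0 => -[_ [+ _]] _; exact. Qed.

Lemma dist_refl x : d x x = 0.
Proof. exact/dist0P. Qed.

Lemma dist_sym x y : d x y = d y x.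
Proof. by case: dCAT0 => -[_ [_ [+ _]]] _; exact. Qed.

Lemma dist_triangle y x z : d x z <= d x y + d y z.
Proof. by case: dCAT0 => -[_ [_ [_ +]]] _; exact. Qed.

Lemma geodesic_exists x y :
  exists c, [/\ isometric_on c (d x y), c 0 = x & c (d x y) = y].
Proof.
case: dCAT0 => _ [/(_ x y) [c [cx [cy ciso]]] _]; exists c; split=> //.
Qed.

Lemma isometric_on_le c L s : isometric_on c L -> s <= L -> isometric_on c s.
Proof.
move=> ciso sL u v /andP[u0 us] /andP[v0 vs].
by apply: ciso; apply/andP; split=> //; exact: le_trans sL.
Qed.

Lemma isometric_on_distE c L s t :
  isometric_on c L -> 0 <= s -> s <= t -> t <= L -> d (c s) (c t) = t - s.
Proof.
move=> ciso s0 st tL; rewrite ciso; last 2 first.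
- by rewrite s0 (le_trans st).
- by rewrite (le_trans s0).
by rewrite distrC ger0_norm // subr_ge0.
Qed.

Lemma isometric_on_rev c L :
  isometric_on c L -> isometric_on (fun s => c (L - s)) L.
Proof.
move=> ciso s t /andP[s0 sL] /andP[t0 tL].
rewrite ciso; last 2 first.
- by apply/andP; split; lra.
- by apply/andP; split; lra.
by rewrite distrC; congr `|_|; ring.
Qed.

Lemma isometric_on_segment c L :
  0 <= L -> isometric_on c L -> geodesic_segment d c (c 0) (c L).
Proof.
move=> L0 ciso.
have cL : d (c 0) (c L) = L by rewrite (isometric_on_distE ciso) // subr0.
by rewrite /geodesic_segment cL; split.
Qed.

(** With one side from (0, 0) to (a, 0), the law of cosines forces [u]; Heron's factorisation gives
    [u ^+ 2 <= b ^+ 2]. *)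
Lemma comparison_point (a b c : R) : 0 < a -> 0 <= b -> 0 <= c ->
  a <= b + c -> b <= a + c -> c <= a + b ->
  exists u v, [/\ u ^+ 2 + v ^+ 2 = b ^+ 2 & (a - u) ^+ 2 + v ^+ 2 = c ^+ 2].
Proof.
move=> a0 b0 c0 abc bac cab.
pose u := (a ^+ 2 + b ^+ 2 - c ^+ 2) / (a *+ 2).
have uE : a * u *+ 2 = a ^+ 2 + b ^+ 2 - c ^+ 2.
  by rewrite /u; field; rewrite gt_eqF.
have ub : 0 <= b ^+ 2 - u ^+ 2.
  rewrite -(@pmulr_rge0 _ (4 * a ^+ 2)); last by rewrite mulr_gt0 // exprn_gt0.
  have -> : 4 * a ^+ 2 * (b ^+ 2 - u ^+ 2) =
    (c - a + b) * (c + a - b) * ((a + b - c) * (a + b + c)).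
    have -> : 4 * a ^+ 2 * (b ^+ 2 - u ^+ 2) =
      4 * a ^+ 2 * b ^+ 2 - (a * u *+ 2) ^+ 2 by ring.
    by rewrite uE; ring.
  by rewrite !mulr_ge0 //; lra.
exists u, (Num.sqrt (b ^+ 2 - u ^+ 2)); rewrite sqr_sqrtr //; split; first by ring.
have -> : (a - u) ^+ 2 + (b ^+ 2 - u ^+ 2) = a ^+ 2 + b ^+ 2 - a * u *+ 2 by ring.
by rewrite uE; ring.
Qed.

(** CAT(0) comparison between the side [c] and the endpoint [z] of the side from [c 0] to [z]; in
    the plane Stewart's formula is an identity. *)
Lemma stewart c L l z : 0 <= L -> isometric_on c L -> 0 <= l <= 1 ->
  d z (c (l * L)) ^+ 2 <=
  (1 - l) * d z (c 0) ^+ 2 + l * d z (c L) ^+ 2 - l * (1 - l) * L ^+ 2.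
Proof.
rewrite le_eqVlt => /orP[/eqP <-|L0] ciso /andP[l0 l1].
  by rewrite mulr0 le_eqVlt; apply/orP; left; apply/eqP; ring.
have cseg := isometric_on_segment (ltW L0) ciso.
have cL : d (c 0) (c L) = L by rewrite (isometric_on_distE ciso) ?subr0 // ltW.
have [e [eiso e0 ez]] := geodesic_exists (c 0) z.
have eseg : geodesic_segment d e (c 0) z by rewrite /geodesic_segment.
have [||||||u [v [uv Luv]]] := @comparison_point L (d (c 0) z) (d (c L) z).
- exact: L0.
- exact: dist_ge0.
- exact: dist_ge0.
- by rewrite -[X in X <= _]cL (dist_sym (c L) z); exact: dist_triangle.
- by rewrite -[X in X + _]cL; exact: dist_triangle.
- by rewrite -[X in X + _]cL (dist_sym (c 0) (c L)); exact: dist_triangle.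
case: dCAT0 => _ [_ /(_ (c 0) (c L) z c e (0, 0) (L, 0) (u, v) cseg eseg)].
rewrite cL /Defs.edist /= !subrr !sub0r !sqrrN expr0n /= addr0.
rewrite sqrtr_sqr (ger0_norm (ltW L0)) uv Luv.
rewrite !sqrtr_sqr !ger0_norm ?dist_ge0 //.
move=> /(_ erefl erefl erefl (l * L) (d (c 0) z)).
have lL : 0 <= l * L <= L by rewrite mulr_ge0 ?ler_piMl // ltW.
move=> /(_ lL); rewrite lexx dist_ge0 => /(_ isT).
rewrite ez !add0r !subr0 mulfK ?gt_eqF // mulr0 sub0r sqrrN.
(* If [z = c 0], the comparison parameter is 0 / 0, which is 0 by convention; this case is computed
   directly. *)
have [b0|b0] := eqVneq (d (c 0) z) 0.
  move: uv; rewrite b0 expr0n /= => /eqP.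
  rewrite paddr_eq0 ?sqr_ge0 // !sqrf_eq0 => /andP[/eqP u0 /eqP v0].
  have zc : c 0 = z by exact/dist0P.
  case/andP: lL => lL0 lL1.
  rewrite -zc dist_refl cL (isometric_on_distE ciso (lexx 0) lL0 lL1).
  move=> _; rewrite subr0 le_eqVlt; apply/orP; left; apply/eqP; ring.
rewrite divff // !mul1r => dle.
have -> : d z (c (l * L)) = d (c (l * L)) z by rewrite dist_sym.
have /le_trans-> // : d (c (l * L)) z ^+ 2 <= (l * L - u) ^+ 2 + v ^+ 2.
  rewrite -[leRHS]sqr_sqrtr ?addr_ge0 ?sqr_ge0 //.
  by rewrite ler_sqr ?nnegrE ?dist_ge0 ?sqrtr_ge0.
rewrite (dist_sym z (c 0)) (dist_sym z (c L)) -uv -Luv.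
by rewrite le_eqVlt; apply/orP; left; apply/eqP; ring.
Qed.

(** Stewart from [c (l * L)] to [c'], with Stewart from [c' L'] to [c] inserted: all terms in [L]
    and [L'] cancel, leaving [l ^+ 2] times the squared third side. *)
Lemma thin_triangle c c' L L' l : 0 <= L -> 0 <= L' ->
  isometric_on c L -> isometric_on c' L' -> c 0 = c' 0 -> 0 <= l <= 1 ->
  d (c (l * L)) (c' (l * L')) <= l * d (c L) (c' L').
Proof.
move=> L0 L0' ciso ciso' c0 l01; have /andP[l0 l1] := l01.
have l1' : 0 <= 1 - l by rewrite subr_ge0.
rewrite -ler_sqr ?nnegrE ?mulr_ge0 ?dist_ge0 //.
have := stewart (c (l * L)) L0' ciso' l01.
have := stewart (c' L') L0 ciso l01.
rewrite -c0 (dist_sym _ (c (l * L))) (dist_sym (c (l * L)) (c 0)).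
rewrite (dist_sym (c' L') (c 0)) {1}c0 (dist_sym (c' L')).
rewrite !(isometric_on_distE ciso) ?(isometric_on_distE ciso') ?mulr_ge0 ?ler_piMl //.
rewrite !subr0 => /(ler_wpM2l l0).
set X := d _ _; set Y := d _ _; set Z := d _ _; nra.
Qed.

Lemma thin_triangle_le c c' L t : 0 < L -> isometric_on c L ->
  isometric_on c' L -> c 0 = c' 0 -> 0 <= t <= L ->
  d (c t) (c' t) <= t / L * d (c L) (c' L).
Proof.
move=> L0 ciso ciso' c0 tL.
have := @thin_triangle c c' L L (t / L) (ltW L0) (ltW L0) ciso ciso' c0.
rewrite divfK ?gt_eqF //; apply.
exact: ratio_itv.
Qed.

(** The diagonal [e] from [c 0] to [c' L] cuts the quadrilateral into two thin triangles; the second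
    one is read backwards from [c' L]. *)
Lemma dist_geodesics_convex c c' L l : 0 <= L -> isometric_on c L ->
  isometric_on c' L -> 0 <= l <= 1 ->
  d (c (l * L)) (c' (l * L)) <= (1 - l) * d (c 0) (c' 0) + l * d (c L) (c' L).
Proof.
move=> L0 ciso ciso' l01; have /andP[l0 l1] := l01.
have [e [eiso e0 eL]] := geodesic_exists (c 0) (c' L).
set M := d (c 0) (c' L) in eiso eL *.
have M0 : 0 <= M by exact: dist_ge0.
have := thin_triangle L0 M0 ciso eiso (esym e0) l01; rewrite eL.
have l01' : 0 <= 1 - l <= 1 by apply/andP; split; lra.
have := thin_triangle M0 L0 (isometric_on_rev eiso) (isometric_on_rev ciso').
move=> /(_ (1 - l)); rewrite !subr0 !subrr eL e0 => /(_ erefl l01').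
have -> : M - (1 - l) * M = l * M by ring.
have -> : L - (1 - l) * L = l * L by ring.
have := dist_triangle (e (l * M)) (c (l * L)) (c' (l * L)).
lra.
Qed.

(** Stewart at [l = s / L] gives the bound [(1 - l) * (d (c 0) z ^+ 2 - s ^+ 2)], and the triangle
    inequality gives [s <= d (c 0) z]. *)
Lemma tracking c L z s : 0 <= L -> isometric_on c L ->
  0 <= s -> d z (c L) <= L - s -> d z (c s) ^+ 2 <= d (c 0) z ^+ 2 - s ^+ 2.
Proof.
move=> L0 ciso s0 zcL.
have sL : s <= L by have := dist_ge0 z (c L); lra.
have sb : s <= d (c 0) z.
  have := dist_triangle z (c 0) (c L).
  by rewrite (isometric_on_distE ciso) //; lra.
move: L0; rewrite le_eqVlt => /orP[/eqP L0|L0].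
  have -> : s = 0 by lra.
  by rewrite dist_sym expr0n subr0.
have l01 : 0 <= s / L <= 1.
  by apply: ratio_itv; rewrite // ?s0 ?(ltW t0).
have := stewart z (ltW L0) ciso l01; rewrite divfK ?gt_eqF //.
move/le_trans; apply; rewrite (dist_sym z (c 0)).
have : d z (c L) ^+ 2 <= (L - s) ^+ 2.
  by rewrite ler_sqr ?nnegrE ?dist_ge0 // subr_ge0.
have sE : s = s / L * L by rewrite divfK // gt_eqF.
have sb2 : s ^+ 2 <= d (c 0) z ^+ 2 by rewrite ler_sqr ?nnegrE ?dist_ge0.
case/andP: l01; move: sb2 sE; move: (s / L) => l + + l0 l1.
move: (d (c 0) z) (d z (c L)) => X Y + sE; rewrite sE.
rewrite -subr_ge0 => /(mulr_ge0 l0) lsb /(ler_wpM2l l0) lY.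
lra.
Qed.

(** The error does not depend on [L], so the value at time [t] controls all later ones. The upper
    bound is Stewart at [t / L], completed to the square of [t + be + q]. *)
Lemma horo_estimate c L z t : isometric_on c L -> 0 < t -> t <= L ->
  d z (c L) - L <= d z (c t) - t <= d z (c L) - L + d (c 0) z ^+ 2 / (t *+ 2).
Proof.
move=> ciso t0 tL; have L0 : 0 < L by exact: lt_le_trans tL.
apply/andP; split.
  have := dist_triangle (c t) z (c L).
  by rewrite (isometric_on_distE ciso) //; lra.
have l01 : 0 <= t / L <= 1.
  by apply: ratio_itv; rewrite // ?s0 ?(ltW t0).
have := stewart z (ltW L0) ciso l01; rewrite divfK ?gt_eqF //.
rewrite (dist_sym z (c 0)); set r := d (c 0) z.
pose be := d z (c L) - L.
have -> : d z (c L) = L + be by rewrite /be; ring.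
have bl : - r <= be.
  have := dist_triangle z (c 0) (c L).
  by rewrite (isometric_on_distE ciso) // /be /r; lra.
have br : be <= r.
  have := dist_triangle (c 0) z (c L).
  rewrite (isometric_on_distE ciso) // ?(ltW L0) // (dist_sym z (c 0)) /be /r; lra.
have b2 : be ^+ 2 <= r ^+ 2 by nra.
pose q := r ^+ 2 / (t *+ 2).
have qE : t * q *+ 2 = r ^+ 2 by rewrite /q; field; rewrite gt_eqF.
have q0 : 0 <= q by rewrite divr_ge0 ?sqr_ge0 // mulrn_wge0 // ltW.
rewrite -/q; set l := t / L in l01 *.
have tE : t = l * L by rewrite divfK // gt_eqF.
clearbody l; case/andP: l01 => l0 l1 ste.
have {}ste : d z (c t) ^+ 2 <= t ^+ 2 + t * be *+ 2 + r ^+ 2.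
  apply: le_trans ste _; rewrite tE.
  have : 0 <= l * (r ^+ 2 - be ^+ 2) by rewrite mulr_ge0 // subr_ge0.
  lra.
(* Squares can be compared only once this sign is known, since [be] may be negative. *)
have pos : 0 <= t + be + q.
  rewrite -(@pmulr_rge0 _ (t *+ 2)) ?mulrn_wgt0 //.
  have -> : t *+ 2 * (t + be + q) = (t + be) ^+ 2 + t ^+ 2 + (t * q *+ 2 - be ^+ 2).
    by ring.
  by rewrite qE; have := sqr_ge0 (t + be); have := sqr_ge0 t; lra.
have : d z (c t) <= t + be + q.
  rewrite -ler_sqr ?nnegrE ?dist_ge0 //; apply: le_trans ste _.
  rewrite -qE; have := sqr_ge0 (be + q); nra.
by rewrite /be; lra.
Qed.

(** * Sequences of speed at most [A] and the geodesics aimed along them *)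

Section Drift.
Variables (x0 : T) (x : nat -> T) (A : R).
Hypothesis A_gt0 : 0 < A.
Hypothesis speed : forall e : R, 0 < e ->
  exists K, forall k, (K <= k)%N -> d x0 (x k) <= (A + e) * k%:R.

(** Moving from [x0] to [x k] brings the end of [c] closer by [A * k%:R - B], which by [speed] is
    the largest possible gain up to o(k). *)
Definition aimed (B : R) (k : nat) (c : R -> T) (L : R) : Prop :=
  [/\ 0 <= L, isometric_on c L, c 0 = x0 & d (x k) (c L) <= L - (A * k%:R - B)].

(** [tracking] at [s = A * k%:R - B] bounds the squared distance by
    [((A + th) * k%:R) ^+ 2 - s ^+ 2], a small multiple of k^2. *)
Lemma aimed_tracking (e B : R) : 0 < e -> 0 <= B ->
  exists K, forall k, (K <= k)%N -> forall c L, aimed B k c L ->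
  d (x k) (c (A * k%:R - B)) <= e * k%:R.
Proof.
have A0 := A_gt0; move=> e0 B0.
have e20 : 0 < e ^+ 2 by rewrite exprn_gt0.
(* The k^2 coefficient [A *+ 2 * th + th ^+ 2] is at most [e ^+ 2 / 2]. [K2] makes the cross term
   2ABk at most the other half, and [K3] makes the tracking time nonnegative. *)
pose th := Num.min 1 (e ^+ 2 / ((A *+ 2 + 1) *+ 2)).
have den0 : 0 < (A *+ 2 + 1) *+ 2 by lra.
have th0 : 0 < th by rewrite lt_min ltr01 divr_gt0.
have th1 : th <= 1 by rewrite ge_min lexx.
have the : (A *+ 2 + 1) * th <= e ^+ 2 / 2.
  have : th <= e ^+ 2 / ((A *+ 2 + 1) *+ 2) by rewrite ge_min lexx orbT.
  rewrite ler_pdivlMr //; lra.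
have [K1 HK1] := speed th0.
have [K2 HK2] := natr_unbounded (A * B * 4 / e ^+ 2).
have [K3 HK3] := natr_unbounded (B / A).
exists (maxn K1 (maxn K2 K3)) => k; rewrite !geq_max => /and3P[/HK1 k1 /HK2 k2 /HK3 k3].
move=> c L [L0 ciso c0 xcL].
move: k2; rewrite ler_pdivrMr // => k2.
move: k3; rewrite ler_pdivrMr // => k3.
have n0 : 0 <= k%:R :> R by [].
have := tracking L0 ciso _ xcL; rewrite c0 subr_ge0 mulrC => /(_ k3).
have : d x0 (x k) ^+ 2 <= ((A + th) * k%:R) ^+ 2.
  by rewrite ler_sqr ?nnegrE ?dist_ge0 ?mulr_ge0 //; lra.
move: (k%:R : R) k2 n0 => n k2 n0 a2 le2.
rewrite mulrC -ler_sqr ?nnegrE ?dist_ge0 ?mulr_ge0 ?(ltW e0) //.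
rewrite (mulrC n) in le2 *; apply: le_trans le2 _.
have h1 : (A *+ 2 * th + th ^+ 2) * n ^+ 2 <= e ^+ 2 / 2 * n ^+ 2.
  have th2 : th ^+ 2 <= th by rewrite expr2 ler_piMl // ltW.
  apply: ler_wpM2r; first exact: sqr_ge0.
  lra.
have := ler_wpM2r n0 k2; have := sqr_ge0 B; lra.
Qed.

(** At time [s = A * k%:R - B] both geodesics are within [eta * k%:R] of [x k]. Thinness scales
    their gap by [t / s] at time [t], and [s] is at least half of [A * k%:R]. *)
Lemma aimed_close (B t e : R) : 0 <= B -> 0 <= t -> 0 < e ->
  exists K, forall k, (K <= k)%N -> forall c L c' L',
  aimed B k c L -> aimed B k c' L' -> t <= L /\ d (c t) (c' t) <= e.
Proof.
have A0 := A_gt0; move=> B0 t0 e0.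
pose eta := A * e / ((t + 1) *+ 4).
have den0 : 0 < (t + 1) *+ 4 by lra.
have eta0 : 0 < eta by rewrite divr_gt0 ?mulr_gt0.
have etaE : eta * (t + 1) *+ 4 = A * e.
  by rewrite /eta; field; apply/negP => /eqP; lra.
have [K1 HK1] := aimed_tracking eta0 B0.
have [K2 HK2] := natr_unbounded ((B *+ 2 + t + 1) / A).
exists (maxn K1 K2) => k; rewrite geq_max => /andP[/HK1 k1 /HK2].
rewrite ler_pdivrMr // => k2 c L c' L' cgood cgood'.
have := k1 _ _ cgood; have := k1 _ _ cgood'.
case: cgood cgood' => [L0 ciso c0 xcL] [L0' ciso' c0' xcL'].
have := dist_ge0 (x k) (c L); have := dist_ge0 (x k) (c' L').
set s := A * k%:R - B in xcL xcL' *.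
have s2 : A * k%:R <= s *+ 2 by rewrite /s; lra.
have s0 : 0 < s by rewrite /s; lra.
have ts : t <= s by rewrite /s; lra.
move=> dL' dL tr' tr.
split; first by lra.
have ciso_s : isometric_on c s by apply: isometric_on_le ciso _; lra.
have ciso_s' : isometric_on c' s by apply: isometric_on_le ciso' _; lra.
have c00 : c 0 = c' 0 by rewrite c0.
have ts0 : 0 <= t <= s by rewrite t0.
apply: le_trans (thin_triangle_le s0 ciso_s ciso_s' c00 ts0) _.
rewrite mulrAC ler_pdivrMr //.
have := dist_triangle (x k) (c s) (c' s); rewrite (dist_sym (c s) (x k)) => tri.
have : t * d (c s) (c' s) <= t * (eta * k%:R *+ 2) by rewrite ler_wpM2l //; lra.
have : eta * k%:R * t *+ 4 <= A * e * k%:R.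
  rewrite -etaE; have := mulr_ge0 (ltW eta0) (ler0n R k); lra.
have : e * (A * k%:R) <= e * (s *+ 2) by rewrite ler_wpM2l // ltW.
lra.
Qed.

(** Approximate [h] at the two points [z] and [x k] by one [hfun x0 y] and take the geodesic from
    [x0] to [y]. The tolerance at [x k] is at most 1, hence [B + 1]. *)
Lemma metric_functional_aimed (h : T -> R) (B : R) (k : nat) (z : T) (e : R) :
  metric_functional d x0 h -> h (x k) <= B - A * k%:R -> 0 < e ->
  exists c L, aimed (B + 1) k c L /\ `|h z - (d z (c L) - L)| <= e.
Proof.
move=> hmf hk e0.
have e0' : 0 < Num.min e 1 by rewrite lt_min e0 ltr01.
have [y Hy] := hmf [set z; x k] (finite_set2 _ _) _ e0'.
have [c [ciso c0 cL]] := geodesic_exists x0 y.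
exists c, (d x0 y); rewrite cL; split.
  split=> //; first exact: dist_ge0.
  rewrite cL; have /Hy := (or_intror erefl : [set z; x k] (x k)).
  by rewrite lt_min => /andP[_]; rewrite /hfun ltr_norml => /andP[]; lra.
have /Hy := (or_introl erefl : [set z; x k] z).
by rewrite lt_min => /andP[/ltW].
Qed.

(* Both functionals are approximated at z by distances to points y, y' towards
   which the orbit progresses at full speed; the geodesics from x0 to such
   points agree up to any given time, and Busemann-type differences at time t
   only miss d x0 z ^+ 2 / (t *+ 2). *)
Lemma metric_functional_unique (h h' : T -> R) (B : R) :
  0 <= B -> metric_functional d x0 h -> metric_functional d x0 h' ->
  (forall k, h (x k) <= B - A * k%:R) ->
  (forall k, h' (x k) <= B - A * k%:R) -> h = h'.
Proof.
move=> B0 hmf hmf' hk hk'; apply/funext => z.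
suff H e : 0 < e -> `|h z - h' z| <= e *+ 5.
  apply/eqP; rewrite -subr_eq0 -normr_le0; apply/ler_addgt0Pr => e e0.
  by rewrite add0r; have := H (e / 5); rewrite divr_gt0 // => /(_ isT); lra.
move=> e0; pose t := (d x0 z ^+ 2 + 1) / e.
have z2 : 0 <= d x0 z ^+ 2 by exact: sqr_ge0.
have t0 : 0 < t by rewrite divr_gt0 //; lra.
have te : d x0 z ^+ 2 / (t *+ 2) <= e.
  have et : e * t = d x0 z ^+ 2 + 1 by rewrite mulrC divfK // gt_eqF.
  by rewrite ler_pdivrMr ?mulrn_wgt0 //; lra.
have B10 : 0 <= B + 1 by lra.
have [K /(_ K (leqnn K)) HK] := aimed_close B10 (ltW t0) e0.
have [c [L [cg hc]]] := metric_functional_aimed z hmf (hk K) e0.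
have [c' [L' [cg' hc']]] := metric_functional_aimed z hmf' (hk' K) e0.
have [tL dc] := HK _ _ _ _ cg cg'; have [tL' _] := HK _ _ _ _ cg' cg.
case: cg cg' => [L0 ciso c0 _] [L0' ciso' c0' _].
have := horo_estimate z ciso t0 tL; have := horo_estimate z ciso' t0 tL'.
rewrite c0 c0' => /andP[e1 e2] /andP[e3 e4].
have := dist_triangle (c t) z (c' t); have := dist_triangle (c' t) z (c t).
rewrite (dist_sym (c' t) (c t)).
move: hc hc'; rewrite !ler_norml => /andP[] + + /andP[].
by move=> *; apply/andP; split; lra.
Qed.

(** The geodesics from [x0] to [y j], for [j >= k], are all aimed at [x k], hence Cauchy at each
    time. The last clause is [horo_estimate] in the limit. *)
Lemma aimed_limit_ray (y : nat -> T) (B : R) : is_complete d -> 0 <= B ->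
  (forall k j, (k <= j)%N -> d (x k) (y j) <= d x0 (y j) - (A * k%:R - B)) ->
  exists c : R -> T, [/\ geodesic_ray d c, c 0 = x0 &
    forall k t, 0 < t ->
      d (x k) (c t) - t <= B - A * k%:R + d x0 (x k) ^+ 2 / (t *+ 2)].
Proof.
move=> dC B0 yaim.
have [c Hc] := choice (fun j => geodesic_exists x0 (y j)).
have caim k j : (k <= j)%N -> aimed B k (c j) (d x0 (y j)).
  move=> kj; have [ciso c0 cL] := Hc j; split=> //; first exact: dist_ge0.
  by rewrite cL; exact: yaim.
have cauchy t e : 0 <= t -> 0 < e -> exists K, forall m n, (K <= m)%N ->
    (K <= n)%N -> t <= d x0 (y m) /\ d (c m t) (c n t) <= e.
  move=> t0 e0; have [K /(_ K (leqnn K)) HK] := aimed_close B0 t0 e0.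
  by exists K => m n Km Kn; apply: HK; exact: caim.
(* The sign condition sits under the existential so that choice yields a function on all of [R]; its
   values at negative times are arbitrary. *)
have limP t : exists l, 0 <= t -> forall e : R, 0 < e ->
    exists N, forall n, (N <= n)%N -> d (c n t) l < e.
  have [t0|] := boolP (0 <= t); last by exists x0.
  have [e e0|l Hl] := dC (fun n => c n t); last by exists l.
  have e20 : 0 < e / 2 by rewrite divr_gt0.
  have [K HK] := cauchy _ _ t0 e20; exists K => m n Km Kn.
  by have [_] := HK _ _ Km Kn; lra.
have [gam Hgam] := choice limP.
have near t e : 0 <= t -> 0 < e -> exists N, forall n, (N <= n)%N ->
    t <= d x0 (y n) /\ d (c n t) (gam t) < e.
  move=> t0 e0; have [K HK] := cauchy _ _ t0 e0; have [N HN] := Hgam _ t0 _ e0.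
  exists (maxn K N) => n; rewrite geq_max => /andP[Kn Nn].
  by split; [have [] := HK _ _ Kn Kn | exact: HN].
exists gam; split.
- move=> s t s0 t0; apply/eqP; rewrite -subr_eq0 -normr_le0.
  apply/ler_addgt0Pr => e e0; rewrite add0r.
  have e20 : 0 < e / 2 by rewrite divr_gt0.
  have [N HN] := near _ _ s0 e20; have [M HM] := near _ _ t0 e20.
  have [sL ds] := HN _ (leq_maxl N M); have [tL dt] := HM _ (leq_maxr N M).
  move: (maxn N M) sL ds tL dt => n sL ds tL dt.
  have [ciso _ _] := Hc n.
  rewrite -ciso ?s0 ?t0 //.
  have := dist_triangle (c n s) (gam s) (gam t).
  have := dist_triangle (c n t) (c n s) (gam t).
  have := dist_triangle (gam s) (c n s) (c n t).
  have := dist_triangle (gam t) (gam s) (c n t).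
  rewrite (dist_sym (gam s) (c n s)) (dist_sym (gam t) (c n t)) ler_norml.
  by move=> *; apply/andP; split; lra.
- apply/dist0P/eqP; rewrite eq_le dist_ge0 andbT.
  apply/ler_addgt0Pr => e e0; rewrite add0r.
  have [N /(_ N (leqnn N)) [_]] := near _ _ (lexx 0) e0.
  by have [_ -> _] := Hc N; rewrite dist_sym => /ltW.
- move=> k t t0; apply/ler_addgt0Pr => e e0.
  have [N HN] := near _ _ (ltW t0) e0.
  have [tL dt] := HN _ (leq_maxl N k).
  have := caim _ _ (leq_maxr N k).
  move: (maxn N k) tL dt => n tL dt [L0 ciso c0 xc].
  have := horo_estimate (x k) ciso t0 tL; rewrite c0 => /andP[_].
  have := dist_triangle (c n t) (x k) (gam t); lra.
Qed.

End Drift.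

(** * Busemann functions of rays *)

Lemma ray_isometric_on gam L : geodesic_ray d gam -> isometric_on gam L.
Proof. by move=> ray s t /andP[s0 _] /andP[t0 _]; exact: ray. Qed.

(** By [horo_estimate], [f] is nonincreasing, so the limit is the infimum [inf E], approached at
    rate 1 / t. *)
Lemma busemann_estimate gam z t : geodesic_ray d gam -> 0 < t ->
  busemann d gam z <= d z (gam t) - t
    <= busemann d gam z + d (gam 0) z ^+ 2 / (t *+ 2).
Proof.
move=> ray; have iso L := @ray_isometric_on gam L ray.
pose f s := d z (gam s) - s.
pose E := [set f s | s in [set s | 0 < s]].
have E_lb : lbound E (- d (gam 0) z).
  move=> _ [s /= s0 <-]; have := dist_triangle z (gam 0) (gam s).
  by rewrite (isometric_on_distE (iso s)) ?(ltW s0) // /f; lra.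
have E_le s : 0 < s -> inf E <= f s.
  by move=> s0; apply: ge_inf; [exists (- d (gam 0) z) | exists s].
have E_ge s : 0 < s -> f s <= inf E + d (gam 0) z ^+ 2 / (s *+ 2).
  move=> s0; rewrite -lerBlDr; apply: lb_le_inf; first by exists (f s), s.
  (* A later time [t0] is handled by the upper half of [horo_estimate], an earlier one by
     monotonicity. *)
  move=> _ [t0 /= t00 <-]; have [st|ts] := leP s t0.
    by have /andP[_] := horo_estimate z (iso t0) s0 st; rewrite /f; lra.
  have /andP[+ _] := horo_estimate z (iso s) t00 (ltW ts).
  have : 0 <= d (gam 0) z ^+ 2 / (s *+ 2).
    by rewrite divr_ge0 ?sqr_ge0 ?mulrn_wge0 ?(ltW s0).
  by rewrite /f; lra.
suff -> : busemann d gam z = inf E.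
  by move=> t0; apply/andP; split; [exact: E_le | exact: E_ge].
rewrite /busemann; apply: (@cvg_lim R^o); first exact: norm_hausdorff.
apply/cvgrPdist_le => e e0; near=> s.
have s0 : 0 < s by near: s; apply: nbhs_pinfty_gt; exact: num_real.
have : d (gam 0) z ^+ 2 / e <= s by near: s; apply: nbhs_pinfty_ge; exact: num_real.
rewrite ler_pdivrMr // => ss.
have : d (gam 0) z ^+ 2 / (s *+ 2) <= e.
  rewrite ler_pdivrMr ?mulrn_wgt0 //; have := mulr_gt0 s0 e0; lra.
have := E_le _ s0; have := E_ge _ s0; rewrite /f.
by rewrite ler_norml => *; apply/andP; split; lra.
Unshelve. all: by end_near. Qed.

Lemma busemann_origin gam : geodesic_ray d gam -> busemann d gam (gam 0) = 0.
Proof.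
move=> ray; have /andP[] := busemann_estimate (gam 0) ray ltr01.
have iso := ray_isometric_on (L := 1) ray.
rewrite (isometric_on_distE iso) // dist_refl expr0n mul0r.
by move=> *; apply/eqP; rewrite eq_le; apply/andP; split; lra.
Qed.

Lemma le_of_decay (a b C : R) : 0 <= C ->
  (forall t, 0 < t -> a <= b + C / (t *+ 2)) -> a <= b.
Proof.
move=> C0 H; apply/ler_addgt0Pr => e e0.
have t0 : 0 < (C + 1) / e by rewrite divr_gt0 //; lra.
apply: le_trans (H _ t0) _; rewrite lerD2l ler_pdivrMr ?mulrn_wgt0 //.
have : e * ((C + 1) / e) = C + 1 by rewrite mulrC divfK // gt_eqF.
by lra.
Qed.

Lemma busemann_ge gam z :
  geodesic_ray d gam -> - d (gam 0) z <= busemann d gam z.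
Proof.
move=> ray; apply: le_of_decay (sqr_ge0 (d (gam 0) z)) _ => t t0.
have /andP[_] := busemann_estimate z ray t0; apply: le_trans.
have := dist_triangle z (gam 0) (gam t).
rewrite (isometric_on_distE (ray_isometric_on (L := t) ray)) ?(ltW t0) //; lra.
Qed.

(** * Horofunctions and metric functionals *)

Lemma busemann_horofunction gam :
  geodesic_ray d gam -> horofunction d (gam 0) (busemann d gam).
Proof.
move=> ray; exists (fun n => gam n%:R) => r e e0.
(* On the ball of radius [r], the error at [gam n%:R] is at most r^2 / (2n), uniformly. *)
have [K HK] := natr_unbounded ((r ^+ 2 + 1) / e).
exists (maxn K 1) => n; rewrite geq_max => /andP[/HK + n1] z zr.
rewrite ler_pdivrMr // => Kn.
have n0 : 0 < n%:R :> R by rewrite ltr0n.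
have zr2 : d (gam 0) z ^+ 2 <= r ^+ 2.
  by rewrite ler_sqr ?nnegrE ?dist_ge0 //; apply: le_trans zr; exact: dist_ge0.
have : d (gam 0) z ^+ 2 / (n%:R *+ 2) < e.
  rewrite ltr_pdivrMr ?mulrn_wgt0 //; have := mulr_gt0 n0 e0; lra.
have := busemann_estimate z ray n0.
rewrite /hfun (isometric_on_distE (ray_isometric_on (L := n%:R) ray)) ?(ltW n0) //.
by rewrite subr0 ltr_norml => /andP[*]; apply/andP; split; lra.
Qed.

Lemma horofunction_base x0 h : horofunction d x0 h -> h x0 = 0.
Proof.
move=> [y Hy]; apply/eqP; rewrite -normr_le0; apply/ler_addgt0Pr => e e0.
rewrite add0r; have [N /(_ N (leqnn N) x0)] := Hy 0 e e0.
by rewrite dist_refl /hfun subrr subr0 => /(_ (lexx _)) /ltW.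
Qed.

Lemma horofunction_metric_functional x0 h :
  horofunction d x0 h -> metric_functional d x0 h.
Proof.
move=> [y Hy] F Ffin e e0.
have [r Fr] : exists r, forall z, F z -> d x0 z <= r.
  have /finite_seqP[s Fs] := finite_image (d x0) Ffin.
  exists (\sum_(i <- s) `|i|) => z Fz.
  have /= zs : [set` s] (d x0 z) by rewrite -Fs; exists z.
  rewrite (big_rem _ zs) /= (le_trans (ler_norm _)) // lerDl.
  exact: sumr_ge0.
have [N /(_ N (leqnn N)) HN] := Hy r e e0.
by exists (y N) => z /Fr; exact: HN.
Qed.

(** Precomposing [hfun x0 y] with [g] and renormalising gives [hfun x0 (ginv y)]. The
    renormalisation evaluates [h] at [g x0], which therefore joins the finite set. *)
Lemma metric_functional_comp x0 g ginv h : is_isometry d g ginv ->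
  metric_functional d x0 h ->
  metric_functional d x0 (fun z => h (g z) - h (g x0)).
Proof.
move=> [giso [gK ginvK]] hmf F Ffin e e0.
have e20 : 0 < e / 2 by rewrite divr_gt0.
have Gfin : finite_set ((g @` F) `|` [set g x0]).
  by rewrite finite_setU; split; [exact: finite_image | exact: finite_set1].
have [y Hy] := hmf _ Gfin _ e20.
exists (ginv y) => z Fz.
have /Hy : ((g @` F) `|` [set g x0]) (g z) by left; exists z.
have /Hy : ((g @` F) `|` [set g x0]) (g x0) by right.
rewrite /hfun -(giso z (ginv y)) -(giso x0 (ginv y)) ginvK !ltr_norml => /andP[? ?] /andP[? ?].
by apply/andP; split; lra.
Qed.

(** * Displacement of isometries and growth of orbits *)

(** The displacement of [g] along the ray is convex in time; being sublinear at arbitrarily late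
    times, it cannot exceed its initial value. *)
Lemma ray_displacement_le gam g : (forall x y, d (g x) (g y) = d x y) ->
  geodesic_ray d gam ->
  (forall e : R, 0 < e -> forall M : R, exists L,
    [/\ 0 < L, M <= L & d (g (gam L)) (gam L) <= e * L]) ->
  forall t, 0 <= t -> d (g (gam t)) (gam t) <= d (g (gam 0)) (gam 0).
Proof.
move=> giso ray sub t t0; apply/ler_addgt0Pr => e e0.
have t10 : 0 < t + 1 by lra.
have e'0 : 0 < e / (t + 1) by rewrite divr_gt0.
have [L [L0 tL dL]] := sub _ e'0 t.
have iso := ray_isometric_on (L := L) ray.
have giso' : isometric_on (g \o gam) L by move=> u v; rewrite /= giso; exact: iso.
have l01 : 0 <= t / L <= 1 by apply: ratio_itv; rewrite ?t0.
have := dist_geodesics_convex (ltW L0) giso' iso l01.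
rewrite divfK ?gt_eqF //= => /le_trans; apply.
case/andP: l01 => l0 l1; apply: lerD.
  by rewrite ler_piMl ?dist_ge0 // gerBl.
apply: le_trans (ler_wpM2l l0 dL) _.
have -> : t / L * (e / (t + 1) * L) = t * e / (t + 1).
  by field; rewrite !gt_eqF.
rewrite ler_pdivrMr //; lra.
Qed.

(** For [m] the midpoint from [x] to [f x], thinness at the vertex [f x] bounds [d m (f m)] by half
    of [d x (f (f x))]. *)
Lemma displacement_double f (a : R) : (forall x y, d (f x) (f y) = d x y) ->
  (forall x, a <= d x (f x)) -> forall x, a *+ 2 <= d x (f (f x)).
Proof.
move=> fiso fa x; have [c [ciso c0 cL]] := geodesic_exists x (f x).
set L := d x (f x) in ciso cL.
have L0 : 0 <= L by exact: dist_ge0.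
have fciso : isometric_on (f \o c) L by move=> u v; rewrite /= fiso; exact: ciso.
have l01 : 0 <= (1 / 2 : R) <= 1 by apply/andP; split; lra.
have := thin_triangle L0 L0 (isometric_on_rev ciso) fciso.
rewrite /= !subr0 subrr cL c0 => /(_ _ erefl l01).
have -> : L - 1 / 2 * L = 1 / 2 * L by field.
by have := fa (c (1 / 2 * L)); lra.
Qed.

Lemma displacement_iter2 f (a : R) k : (forall x y, d (f x) (f y) = d x y) ->
  (forall x, a <= d x (f x)) ->
  forall x, a * (2 ^ k)%:R <= d x (iter (2 ^ k) f x).
Proof.
move=> fiso fa; elim: k => [|k IH] x; first by rewrite expn0 mulr1.
rewrite expnS mul2n -addnn iterD addnn -mul2n natrM mulrCA mulr_natl.
by apply: displacement_double IH x; elim: (2 ^ k)%N => //= n IHn y z; rewrite fiso.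
Qed.

Lemma iter_isometry g n x y : (forall x y, d (g x) (g y) = d x y) ->
  d (iter n g x) (iter n g y) = d x y.
Proof. by move=> giso; elim: n => //= n IHn; rewrite giso. Qed.

Lemma orbit_dist g k n x : (forall x y, d (g x) (g y) = d x y) -> (k <= n)%N ->
  d (iter k g x) (iter n g x) = d x (iter (n - k) g x).
Proof.
by move=> giso kn; rewrite -{1}(subnKC kn) iterD iter_isometry.
Qed.

Lemma orbit_dist_le g n x : (forall x y, d (g x) (g y) = d x y) ->
  d x (iter n g x) <= d x (g x) * n%:R.
Proof.
move=> giso; elim: n => [|n IHn]; first by rewrite dist_refl mulr0.
have := dist_triangle (iter n g x) x (iter n.+1 g x).
by rewrite iterSr iter_isometry // -natr1; lra.
Qed.

Lemma transl_length_le g x : transl_length d g <= d x (g x).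
Proof.
apply: ge_inf; last by exists x.
by exists 0 => _ [z _ <-]; exact: dist_ge0.
Qed.

(** Some [y] has displacement below the infimum plus [e / 2]. The orbits of [x0] and [y] stay at
    constant distance, which the other half of [e] absorbs. *)
Lemma orbit_speed g x0 e : (forall x y, d (g x) (g y) = d x y) -> 0 < e ->
  exists K, forall k, (K <= k)%N ->
    d x0 (iter k g x0) <= (transl_length d g + e) * k%:R.
Proof.
move=> giso e0.
have [_ [y _ <-] ylt] : exists2 r, [set d x (g x) | x in setT] r
    & r < transl_length d g + e / 2.
  apply: inf_lt; first by exists (d x0 (g x0)), x0.
  by rewrite ltrDl divr_gt0.
have [K HK] := natr_unbounded (d x0 y *+ 4 / e).
exists K => k /HK; rewrite ler_pdivrMr // => Kk.
have := dist_triangle y x0 (iter k g x0).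
have := dist_triangle (iter k g y) y (iter k g x0).
rewrite iter_isometry // (dist_sym y x0).
have := orbit_dist_le k y giso.
have : d y (g y) * k%:R <= (transl_length d g + e / 2) * k%:R.
  by rewrite ler_wpM2r // ltW.
lra.
Qed.

Lemma argmax_initial (b : nat -> R) n :
  exists2 m, (m <= n)%N & forall i, (i <= n)%N -> b i <= b m.
Proof.
elim: n => [|n [m mn bm]]; first by exists 0 => // i; rewrite leqn0 => /eqP ->.
have [bn|bn] := leP (b n.+1) (b m).
  exists m => [|i]; first exact: leqW.
  by rewrite leq_eqVlt => /orP[/eqP -> //|]; exact: bm.
exists n.+1 => // i; rewrite leq_eqVlt => /orP[/eqP -> //|].
by move=> /bm bi; exact: le_trans (ltW bn).
Qed.

(** If [b] is bounded above, the bound serves as slack at any [n] with [0 <= b n]; otherwise exact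
    running maxima occur arbitrarily late. *)
Lemma almost_records (b : nat -> R) :
  (forall N, exists2 n, (N <= n)%N & 0 <= b n) ->
  exists2 B, 0 <= B & forall N, exists2 n, (N <= n)%N &
    forall m, (m <= n)%N -> b m <= b n + B.
Proof.
move=> b0; have [[M bM]|unb] := pselect (exists M, forall m, b m <= M).
  have M0 : 0 <= M by have [n _ /le_trans] := b0 0%N; apply.
  exists M => // N; have [n Nn bn] := b0 N; exists n => // m _.
  by apply: le_trans (bM m) _; rewrite lerDr.
exists 0 => // N; have [p _ bp] := argmax_initial b N.
have [q bq] : exists q, b p < b q.
  apply: contrapT => nq; apply: unb; exists (b p) => m.
  by rewrite leNgt; apply/negP => ?; apply: nq; exists m.
(* As [b q] exceeds every value of [b] up to [N], this maximum cannot be attained before [N]. *)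
have [n nNq bn] := argmax_initial b (maxn N q).
exists n => [|m mn].
  rewrite leqNgt; apply/negP => /ltnW /bp.
  by rewrite leNgt (lt_le_trans bq) // bn // leq_maxr.
by rewrite addr0 bn // (leq_trans mn).
Qed.

(** [y j] is the orbit point at an almost-record time [u j >= j]. Its distance to the k-th orbit
    point is that from [x0] to the orbit point at time [u j - k], so the record inequality at that
    index applies. *)
Lemma orbit_aimed g x0 : (forall x y, d (g x) (g y) = d x y) ->
  0 < transl_length d g ->
  exists y B, 0 <= B /\ forall k j : nat, (k <= j)%N ->
    d (iter k g x0) (y j) <= d x0 (y j) - (transl_length d g * k%:R - B).
Proof.
set A := transl_length d g => giso A0.
pose b n := d x0 (iter n g x0) - A * n%:R.
have [N|B B0 HB] := almost_records (b := b).
  exists (2 ^ N)%N; first exact/ltnW/ltn_expl.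
  by rewrite subr_ge0; apply: displacement_iter2 => // x; exact: transl_length_le.
have [u Hu] : exists u : nat -> nat, forall j, (j <= u j)%N /\
    forall m, (m <= u j)%N -> b m <= b (u j) + B.
  have [j|u Hu] := choice (P := fun j n => (j <= n)%N /\
    forall m, (m <= n)%N -> b m <= b n + B); last by exists u.
  by have [n jn bn] := HB j; exists n.
exists (fun j => iter (u j) g x0), B; split=> // k j kj.
have [ju bu] := Hu j; have ku := leq_trans kj ju.
have := bu _ (leq_subr k (u j)).
rewrite orbit_dist // /b natrB //; lra.
Qed.

End Geometry.

(** * The fixed boundary point and its Busemann function *)

Theorem theorem20 (R : realType) (T : Type) (d : T -> T -> R) (x0 : T)
    (g ginv : T -> T) :
  is_CAT0 d -> is_complete d -> is_isometry d g ginv ->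
  0 < transl_length d g ->
  exists gam : R -> T,
    geodesic_ray d gam /\ gam 0 = x0 /\
    rays_equiv d (g \o gam) gam /\
    metric_functional d x0 (busemann d gam) /\
    act x0 ginv (busemann d gam) = busemann d gam /\
    horofunction d x0 (busemann d gam) /\
    (forall x, busemann d gam (g x) = busemann d gam x - transl_length d g) /\
    (forall h : T -> R, horofunction d x0 h ->
        (forall x, h (g x) = h x - transl_length d g) -> h = busemann d gam) /\
    ((fun n : nat => d (iter n g x0) (gam (transl_length d g * n%:R)) / n%:R)
          @ \oo --> 0%R).
Proof.
move=> dCAT0 dC isog A0; have [giso [gK ginvK]] := isog.
have speed e := @orbit_speed _ _ _ dCAT0 g x0 e giso.
have [y [B [B0 yaim]]] := orbit_aimed dCAT0 x0 giso A0.
have [gam [ray gam0 Hgam]] := aimed_limit_ray dCAT0 A0 speed dC B0 yaim.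
set A := transl_length d g in A0 speed yaim Hgam *.
pose x k := iter k g x0; pose h := busemann d gam.
have hle k : h (x k) <= B - A * k%:R.
  apply: le_of_decay (sqr_ge0 (d x0 (x k))) _ => t t0.
  have /andP[+ _] := busemann_estimate dCAT0 (x k) ray t0.
  by move/le_trans; apply; exact: Hgam.
have hhoro : horofunction d x0 h by rewrite -gam0; exact: busemann_horofunction.
have hmf := horofunction_metric_functional hhoro.
have unique h' B' : metric_functional d x0 h' ->
    (forall k, h' (x k) <= B' - A * k%:R) -> h' = h.
  move=> h'mf h'le; pose M := Num.max B B'.
  have M0 : 0 <= M by rewrite le_max B0.
  apply: (metric_functional_unique dCAT0 A0 speed M0) => // k.
    by apply: le_trans (h'le k) _; rewrite lerD2r le_max lexx orbT.
  by apply: le_trans (hle k) _; rewrite lerD2r le_max lexx.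
(* Since [g] sends [x k] to [x k.+1], the translate of [h] also decays at rate [A] along the orbit,
   so [unique] applies to it. *)
have hg z : h (g z) = h z + h (g x0).
  have /(congr1 (@^~ z)) /= <- : (fun z => h (g z) - h (g x0)) = h.
    apply: (unique _ (B - h (g x0))); first exact: metric_functional_comp isog hmf.
    by move=> k; have := hle k.+1; rewrite /x iterS -natr1; lra.
  by rewrite subrK.
have hx0 : h x0 = 0 by rewrite /h -gam0; exact: busemann_origin.
have hx k : h (x k) = h (g x0) * k%:R.
  elim: k => [|k IH]; first by rewrite mulr0.
  by rewrite /x iterS hg -/(x k) IH -natr1; ring.
(* Divide [h (x k)] by [k]: [hle] gives the upper bound, and [h >= - d x0] with [speed] gives the
   lower one. *)
have hgA : h (g x0) = - A.
  apply/eqP; rewrite eq_le; apply/andP; split; apply/ler_addgt0Pr => e e0.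
    have [K HK] := natr_unbounded ((B + 1) / e).
    have := HK K (leqnn _); rewrite ler_pdivrMr // => Ke.
    have K0 : 0 < K%:R :> R by rewrite -(pmulr_lgt0 _ e0); lra.
    by rewrite -(ler_pM2r K0); have := hle K; rewrite hx; lra.
  have [K /(_ K.+1 (leqnSn _))] := speed _ e0.
  have K0 : 0 < K.+1%:R :> R by rewrite ltr0n.
  move=> sp; rewrite -(ler_pM2r K0).
  have := busemann_ge dCAT0 (x K.+1) ray; rewrite gam0 -/(h _) hx; lra.
have track e : 0 < e -> exists K, forall k, (K <= k)%N ->
    d (x k) (gam (A * k%:R)) <= e * k%:R.
  move=> e0; have e20 : 0 < e / 2 by rewrite divr_gt0.
  have B10 : 0 <= B + 1 by lra.
  have [K1 HK1] := aimed_tracking dCAT0 A0 speed e20 B10.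
  have [K2 HK2] := natr_unbounded ((B + 1) / A).
  have [K3 HK3] := natr_unbounded ((B + 1) / (e / 2)).
  exists (maxn K1 (maxn K2 K3)) => k.
  rewrite !geq_max => /and3P[/HK1 + /HK2 + /HK3].
  rewrite !ler_pdivrMr // => k1 k2 k3.
  (* So late a time makes the error in [Hgam] at most 1, and [gam] itself is aimed at [x k] with
     constant [B + 1]. *)
  pose L := d x0 (x k) ^+ 2 + 1.
  have L0 : 0 < L by rewrite ltr_wpDl ?sqr_ge0.
  have /k1 : aimed d x0 x A (B + 1) k gam L.
    split=> //; [exact: ltW | exact: ray_isometric_on |].
    have := Hgam k L L0.
    have : d x0 (x k) ^+ 2 / (L *+ 2) <= 1.
      rewrite ler_pdivrMr ?mulrn_wgt0 // /L; have := sqr_ge0 (d x0 (x k)); lra.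
    by rewrite /x; lra.
  have := dist_triangle dCAT0 (gam (A * k%:R - (B + 1))) (x k) (gam (A * k%:R)).
  have iso := ray_isometric_on (L := A * k%:R) ray.
  rewrite (isometric_on_distE iso) //; lra.
exists gam; split; first exact: ray.
split; first exact: gam0.
split.
  exists (d (g (gam 0)) (gam 0)).
  (* At time [A * k%:R], the path from the image under [g] through [x k.+1] and [gam (A * k.+1%:R)]
     back to the ray has length at most [A * e / 4 * (k%:R + k.+1%:R) + A], which is at most
     [e * (A * k%:R)] for large [k]. *)
  apply: (ray_displacement_le dCAT0 giso ray) => e e0 M.
  have eA0 : 0 < A * e / 4 by rewrite divr_gt0 ?mulr_gt0.
  have [K HK] := track _ eA0.
  have [K2 HK2] := natr_unbounded (M / A).
  have [K3 HK3] := natr_unbounded (4 / e).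
  pose k := (maxn K (maxn K2 (maxn K3 1))).
  have : (k <= k)%N by [].
  rewrite {1}/k !geq_max => /and4P[k1 /HK2 k2 /HK3 k3 k4].
  move: k2 k3; rewrite !ler_pdivrMr // => k2 k3.
  have k0 : 1 <= k%:R :> R by rewrite ler1n.
  exists (A * k%:R); split.
  - by rewrite mulr_gt0 // ltr0n.
  - by rewrite mulrC.
  have := dist_triangle dCAT0 (x k.+1) (g (gam (A * k%:R))) (gam (A * k%:R)).
  have := dist_triangle dCAT0 (gam (A * k.+1%:R)) (x k.+1) (gam (A * k%:R)).
  have : d (g (gam (A * k%:R))) (x k.+1) <= A * e / 4 * k%:R.
    by rewrite (dist_sym dCAT0) /x iterS giso; exact: HK.
  have := HK k.+1 (leqW k1).
  have iso := ray_isometric_on (L := A * k.+1%:R) ray.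
  have AS : A * k%:R <= A * k.+1%:R by rewrite ler_pM2l // ler_nat.
  have Ak : 0 <= A * k%:R by rewrite mulr_ge0 // ltW.
  rewrite (dist_sym dCAT0 (gam (A * k.+1%:R)) (gam (A * k%:R))).
  rewrite (isometric_on_distE iso) // -natr1.
  have := ler_wpM2l (ltW A0) k3.
  have := ler_wpM2l (ltW eA0) k0.
  lra.
split; first exact: hmf.
have hgx z : h (g z) = h z - A by rewrite hg hgA.
split.
  apply/funext => z; rewrite /act -/h.
  have := hgx (ginv z); have := hgx (ginv x0); rewrite !ginvK; lra.
split; first exact: hhoro.
split; first exact: hgx.
split.
  (* The normalisation [h' x0 = 0] makes [h' (x k)] exactly [- (A * k%:R)], so the constant is 0. *)
  move=> h' h'horo h'g; apply: (unique h' 0).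
    exact: horofunction_metric_functional.
  elim=> [|k IH]; first by rewrite (horofunction_base dCAT0 h'horo) mulr0 subr0.
  by rewrite /x iterS h'g -/(x k) -natr1; lra.
apply/cvgrPdist_le => e e0; have [K HK] := track _ e0.
exists (maxn K 1) => // n /=; rewrite geq_max => /andP[/HK Kn n1].
rewrite sub0r normrN ger0_norm ?divr_ge0 ?(dist_ge0 dCAT0) //.
by rewrite ler_pdivrMr // ltr0n.
Qed.
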